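(* Let $\gamma=\{\gamma(n)\}_{n=0,1,2,\dots}$ be a sequence of positive numbers with $\inf_n\gamma(n)>0$. If $$\liminf_{n\to\infty}\frac{\gamma(n)}{(\log n)^{1/2}}=0,$$ then there exist two real-valued functions $f$ and $g$ on $\mathbb T$ such that $f\in A_\gamma(\mathbb T)$ and $g\in W_2^{1/2}(\mathbb T)\cap V(\mathbb T)\cap C(\mathbb T)$ but $fg\notin U(\mathbb T)$.
   Context: $\mathbb T=\mathbb R/(2\pi\mathbb Z)$; functions on $\mathbb T$ are identified with $2\pi$-periodic functions on $\mathbb R$. $C(\mathbb T)$ is the space of continuous (complex-valued) functions on $\mathbb T$ with the sup norm. Fourier coefficients: $\widehat f(k)=\frac1{2\pi}\int_{\mathbb T}f(t)e^{-ikt}dt$, and $S_N(f)(t)=\sum_{|k|\le N}\widehat f(k)e^{ikt}$. $U(\mathbb T)$ is the space of all $f\in C(\mathbb T)$ such that $\|f-S_N(f)\|_{C(\mathbb T)}\to0$ as $N\to\infty$. $A_\gamma(\mathbb T)$ is the space of all $f\in C(\mathbb T)$ with $\sum_{k\in\mathbb Z}|\widehat f(k)|\gamma(|k|)<\infty$. $V(\mathbb T)$ is the space of functions of bounded variation on $\mathbb T$. $W_2^{1/2}(\mathbb T)$ is the space of integrable functions $f$ on $\mathbb T$ with $\sum_{k\in\mathbb Z}|\widehat f(k)|^2|k|<\infty$. *)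

(* Defs.v *)
From HB Require Import structures.
From mathcomp Require Import all_boot all_order all_algebra.
From mathcomp Require Import complex.
From mathcomp Require Import all_classical all_reals all_analysis.

Set Implicit Arguments.
Unset Strict Implicit.
Unset Printing Implicit Defensive.

Import Order.TTheory GRing.Theory Num.Theory.
Import numFieldNormedType.Exports.
Import Normc.

Local Open Scope classical_set_scope.
Local Open Scope complex_scope.
Local Open Scope ring_scope.

(* Functions on the circle are 2pi-periodic functions on the real line. *)
Section Circle.
Context {R : realType}.
Implicit Types (f : R -> R[i]) (k : int) (N : nat) (gamma : nat -> R).

Local Notation mu := (@lebesgue_measure R).
Local Notation period := (`[0, pi *+ 2]%classic : set R).

Definition cis (t : R) : R[i] := cos t +i* sin t.

Definition cintegral (D : set R) f : R[i] :=
  Rintegral mu D (fun t => complex.Re (f t)) +i*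
  Rintegral mu D (fun t => complex.Im (f t)).

Definition cintegrable (D : set R) f : Prop :=
  mu.-integrable D (fun t => (complex.Re (f t))%:E) /\
  mu.-integrable D (fun t => (complex.Im (f t))%:E).

Definition fourier_coef f k : R[i] :=
  ((pi *+ 2)^-1)%:C * cintegral period (fun t => f t * cis (- (k%:~R * t))).

(* The frequency is k = j - N, so it runs over -N, ..., N. *)
Definition fourier_sum N f : R -> R[i] := fun t =>
  \sum_(j < (N.*2).+1)
    (let k := (j : nat)%:Z - N%:Z in fourier_coef f k * cis (k%:~R * t)).

(* The regular algebra R[i]^o carries the norm topology of R[i]. *)
Definition C_T : set (R -> R[i]) :=
  [set f | periodic f (pi *+ 2) /\ continuous (f : R -> R[i]^o)].

(* Only meaningful for bounded f, as sup is 0 on unbounded sets. *)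
Definition sup_norm f : R := sup [set normc (f t) | t in [set: R]].

Definition U_T : set (R -> R[i]) :=
  [set f | C_T f /\
    sup_norm (fun t => f t - fourier_sum N f t) @[N --> \oo] --> (0 : R)].

Definition A_T gamma : set (R -> R[i]) :=
  [set f | C_T f /\
    (\esum_(k in [set: int])
       (normc (fourier_coef f k) * gamma (absz k))%:E < +oo)%E].

Definition W_T : set (R -> R[i]) :=
  [set f | periodic f (pi *+ 2) /\ cintegrable period f /\
    (\esum_(k in [set: int])
       (normc (fourier_coef f k) ^+ 2 * (absz k)%:R)%:E < +oo)%E].

(* By periodicity, the variation over the circle is that over one period. *)
Definition V_T : set (R -> R) :=
  [set g | periodic g (pi *+ 2) /\ bounded_variation 0 (pi *+ 2) g].

End Circle.

(* Main.v *)
Require Import Defs.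
From HB Require Import structures.
From mathcomp Require Import all_boot all_order all_algebra.
From mathcomp Require Import complex.
From mathcomp Require Import all_classical all_reals all_analysis.
From mathcomp Require Import ring lra zify.

(* Take f = sum_j a_j sin(n_j t) and g = sum_j w_j F_(n_j)(t), where
   F_n(t) = sum_(1 <= k <= n) (1 - k/(n+1)) sin(kt) / k. Since F_n' + 1/2 is half the
   Fejer kernel, F_n + t/2 is nondecreasing, so the F_n are uniformly bounded and of
   uniformly bounded variation, while their squared W_2^(1/2) norms are at most the
   harmonic number H_n; with w_j = 2^-j / sqrt(H_(n_j)) the series g is admissible.
   The N-th partial sum at 0 of sin(mt) sin(pt) is ([|m-p| <= N] - [m+p <= N]) / 2 >= 0.
   Hence all terms of S_N(fg)(0) are nonnegative, no separation of the frequencies is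
   needed, and keeping only the j-th diagonal term gives
   S_(n_j)(fg)(0) >= a_j w_j (H_(n_j) - 1) / 2. With a_j = 2^-j / gamma(n_j) and n_j
   such that gamma(n_j) <= 8^-j sqrt(log n_j), this is at least 2^j / 4, whereas
   fg(0) = 0. *)

Import Order.TTheory GRing.Theory Num.Theory.
Import numFieldNormedType.Exports.
Import Normc.

Local Open Scope classical_set_scope.
Local Open Scope complex_scope.
Local Open Scope ring_scope.

(** * Mean values and Fourier coefficients of real functions *)

Definition mean {R : realType} (h : R -> R) : R :=
  (pi *+ 2)^-1 * Rintegral lebesgue_measure `[0, pi *+ 2] h.

Lemma continuous_integrable_period {R : realType} (h : R -> R) :
  continuous h ->
  lebesgue_measure.-integrable `[0, pi *+ 2] (fun t => (h t)%:E).
Proof.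
move=> hc; apply: (@continuous_compact_integrable R h).
  exact: segment_compact.
exact: continuous_subspaceT.
Qed.

Lemma pi2_gt0 {R : realType} : 0 < (pi *+ 2 : R).
Proof. by rewrite mulrn_wgt0// pi_gt0. Qed.

Lemma meanD {R : realType} (u v : R -> R) : continuous u -> continuous v ->
  mean (fun t => u t + v t) = mean u + mean v.
Proof.
move=> uc vc; rewrite /mean -mulrDr RintegralD//.
- exact: continuous_integrable_period.
- exact: continuous_integrable_period.
Qed.

Lemma meanZ {R : realType} (a : R) (u : R -> R) : continuous u ->
  mean (fun t => a * u t) = a * mean u.
Proof.
move=> uc; rewrite /mean RintegralZl//; first by rewrite mulrCA.
exact: continuous_integrable_period.
Qed.

Lemma continuous_sum {R : realType} (I : Type) (r : seq I) (u : I -> R -> R) :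
  (forall i, continuous (u i)) -> continuous (fun t => \sum_(i <- r) u i t).
Proof.
move=> uc t; elim: r => [|i r IH].
  by under eq_fun do rewrite big_nil; exact: cvg_cst.
under eq_fun do rewrite big_cons.
by apply: continuousD => //; exact: uc.
Qed.

Lemma mean_sum {R : realType} (I : Type) (r : seq I) (u : I -> R -> R) :
  (forall i, continuous (u i)) ->
  mean (fun t => \sum_(i <- r) u i t) = \sum_(i <- r) mean (u i).
Proof.
move=> uc; elim: r => [|i r IH].
  under eq_fun do rewrite big_nil.
  by rewrite big_nil /mean Rintegral_cst// mul0r mulr0.
under eq_fun do rewrite big_cons.
by rewrite big_cons -IH meanD//; exact: continuous_sum.
Qed.

Lemma mean_bound {R : realType} (u : R -> R) (M : R) : continuous u ->
  (forall t, `|u t| <= M) -> `|mean u| <= M.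
Proof.
move=> uc uM; rewrite /mean normrM gtr0_norm ?invr_gt0 ?pi2_gt0//.
rewrite ler_pdivrMl ?pi2_gt0//.
have uI := continuous_integrable_period _ uc.
apply: (@le_trans _ _ (Rintegral lebesgue_measure `[0, pi *+ 2] (fun t => `|u t|))).
  exact: le_normr_Rintegral.
have -> : pi *+ 2 * M = Rintegral lebesgue_measure `[0, pi *+ 2] (fun=> M).
  rewrite Rintegral_cst//= lebesgue_measure_itv/= lte_fin pi2_gt0/=.
  by rewrite oppr0 addr0 mulrC.
apply: le_Rintegral => //.
- apply: continuous_integrable_period => x.
  exact: (continuous_comp (uc x) (@norm_continuous _ _ _)).
- by apply: continuous_integrable_period => x; exact: cvg_cst.
Qed.

Lemma continuous_cosM {R : realType} (a : R) : continuous (fun t => cos (a * t)).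
Proof.
move=> t; apply: (@continuous_comp _ _ _ (fun t => a * t) cos).
  exact: mulrl_continuous.
exact: continuous_cos.
Qed.

Lemma continuous_sinM {R : realType} (a : R) : continuous (fun t => sin (a * t)).
Proof.
move=> t; apply: (@continuous_comp _ _ _ (fun t => a * t) sin).
  exact: mulrl_continuous.
exact: continuous_sin.
Qed.

Lemma is_derive_sinM {R : realType} (a t : R) :
  is_derive t 1 (fun t => sin (a * t)) (a * cos (a * t)).
Proof.
have dl : is_derive t 1 (fun t => a * t) a.
  have := @is_deriveZ R R R id a t 1 1 (is_derive_id _ _).
  by rewrite /GRing.scale/= mulr1.
have := @is_derive1_comp R sin (fun t => a * t) t _ _ (is_derive_sin _) dl.
by rewrite /GRing.scale/= mulrC.
Qed.

Lemma is_derive_cosM {R : realType} (a t : R) :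
  is_derive t 1 (fun t => cos (a * t)) (- (a * sin (a * t))).
Proof.
have dl : is_derive t 1 (fun t => a * t) a.
  have := @is_deriveZ R R R id a t 1 1 (is_derive_id _ _).
  by rewrite /GRing.scale/= mulr1.
have := @is_derive1_comp R cos (fun t => a * t) t _ _ (is_derive_cos _) dl.
by rewrite /GRing.scale/= mulrC mulrN.
Qed.

(** By the fundamental theorem of calculus the mean is a boundary difference of the primitive. With
    trigonometric primitives this yields all the orthogonality relations below. *)
Lemma mean_derive {R : realType} (f F : R -> R) : continuous f ->
  (forall t : R, is_derive t 1 F (f t)) -> F (pi *+ 2) = F 0 -> mean f = 0.
Proof.
move=> fc dF F02.
have Fc : continuous F.
  move=> t; apply/differentiable_continuous/derivable1_diffP.
  exact: (@ex_derive _ _ _ _ _ _ _ (dF t)).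
rewrite /mean /Rintegral (@continuous_FTC2 R f F).
- by rewrite /= F02 subrr mulr0.
- exact: pi2_gt0.
- exact: continuous_subspaceT.
- split.
  + by move=> t _; exact: (@ex_derive _ _ _ _ _ _ _ (dF t)).
  + exact/cvg_at_right_filter/Fc.
  + exact/cvg_at_left_filter/Fc.
- move=> t _; rewrite derive1E; exact: (@derive_val _ _ _ _ _ _ _ (dF t)).
Qed.

Lemma cos_int_period {R : realType} (k : int) (t : R) :
  cos (k%:~R * (t + pi *+ 2)) = cos (k%:~R * t).
Proof.
rewrite mulrDr; case: k => n.
  by rewrite -pmulrn [_ * (pi *+ 2)]mulr_natl (periodicn (@cosD2pi R)).
rewrite NegzE mulrNz !mulNr -opprD !cosN -pmulrn.
by rewrite [_ * (pi *+ 2)]mulr_natl (periodicn (@cosD2pi R)).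
Qed.

Lemma sin_int_period {R : realType} (k : int) (t : R) :
  sin (k%:~R * (t + pi *+ 2)) = sin (k%:~R * t).
Proof.
rewrite mulrDr; case: k => n.
  by rewrite -pmulrn [_ * (pi *+ 2)]mulr_natl (periodicn (@sinD2pi R)).
rewrite NegzE mulrNz !mulNr -opprD !sinN -pmulrn.
by rewrite [_ * (pi *+ 2)]mulr_natl (periodicn (@sinD2pi R)).
Qed.

Lemma mean_cos {R : realType} (k : int) :
  mean (fun t : R => cos (k%:~R * t)) = (k == 0)%:R.
Proof.
have [->|k0] := eqVneq k 0.
  rewrite (_ : (fun _ => _) = fun=> 1); last first.
    by apply/funext => t; rewrite mul0r cos0.
  rewrite /mean Rintegral_cst//= lebesgue_measure_itv/= lte_fin pi2_gt0/=.
  by rewrite oppr0 addr0 mul1r mulVf// gt_eqF// pi2_gt0.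
have kR0 : k%:~R != 0 :> R by rewrite intr_eq0.
apply: (@mean_derive _ _ (fun t => k%:~R^-1 * sin (k%:~R * t))).
- exact: continuous_cosM.
- move=> t; have := @is_deriveZ R R R _ k%:~R^-1 t 1 _ (is_derive_sinM k%:~R t).
  by rewrite /GRing.scale/= mulKf.
- by rewrite -[X in sin (_ * X)]add0r sin_int_period.
Qed.

Lemma mean_sin {R : realType} (k : int) :
  mean (fun t : R => sin (k%:~R * t)) = 0.
Proof.
have [->|k0] := eqVneq k 0.
  rewrite (_ : (fun _ => _) = fun=> 0); last first.
    by apply/funext => t; rewrite mul0r sin0.
  by rewrite /mean Rintegral_cst//= mul0r mulr0.
have kR0 : k%:~R != 0 :> R by rewrite intr_eq0.
apply: (@mean_derive _ _ (fun t => - k%:~R^-1 * cos (k%:~R * t))).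
- exact: continuous_sinM.
- move=> t; have := @is_deriveZ R R R _ (- k%:~R^-1) t 1 _ (is_derive_cosM k%:~R t).
  by rewrite /GRing.scale/= mulNr mulrN opprK mulKf.
- by rewrite -[X in cos (_ * X)]add0r cos_int_period.
Qed.

Definition cosc {R : realType} (h : R -> R) (k : int) : R :=
  mean (fun t => h t * cos (k%:~R * t)).

Definition sinc {R : realType} (h : R -> R) (k : int) : R :=
  mean (fun t => h t * sin (k%:~R * t)).

Lemma continuous_mulcos {R : realType} (h : R -> R) (a : R) : continuous h ->
  continuous (fun t => h t * cos (a * t)).
Proof.
by move=> hc t; apply: continuousM; [exact: hc|exact: continuous_cosM].
Qed.

Lemma continuous_mulsin {R : realType} (h : R -> R) (a : R) : continuous h ->
  continuous (fun t => h t * sin (a * t)).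
Proof.
by move=> hc t; apply: continuousM; [exact: hc|exact: continuous_sinM].
Qed.

Lemma fourier_coefE {R : realType} (h : R -> R) (k : int) : continuous h ->
  fourier_coef (fun t => (h t)%:C) k = cosc h k +i* - sinc h k.
Proof.
move=> hc; rewrite -[in RHS]mulN1r /sinc -meanZ; last exact: continuous_mulsin.
rewrite /fourier_coef /cintegral /cosc /mean.
have -> : (fun t => complex.Re ((h t)%:C * cis (- (k%:~R * t)))) =
    (fun t => h t * cos (k%:~R * t)).
  by apply/funext => t; rewrite /cis; simpc; rewrite /= cosN.
have -> : (fun t => complex.Im ((h t)%:C * cis (- (k%:~R * t)))) =
    (fun t => -1 * (h t * sin (k%:~R * t))).
  by apply/funext => t; rewrite /cis; simpc; rewrite /= sinN mulrN.
by simpc.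
Qed.

(** * Dyadically convergent limits of functions *)

(** Uniform convergence with a fixed geometric rate, so that one constant passes through products.
    For partial sums, which are empty at [J = 0], it also bounds [h] itself. *)
Definition dyadic_limit {R : realType} (H : nat -> R -> R) (M : R) (h : R -> R) :=
  forall J t, `|h t - H J t| <= M / 2 ^+ J.

Lemma dyadic_cvg0 {R : realType} (M : R) : M / 2 ^+ J @[J --> \oo] --> (0 : R).
Proof.
rewrite (_ : (fun J => _) = geometric M 2^-1); last first.
  by apply/funext => J; rewrite /geometric/= exprVn.
by apply: cvg_geometric; rewrite ger0_norm ?invr_ge0// invf_lt1// ltr1n.
Qed.

(** The Weierstrass test; the factor 2 comes from summing the geometric tail from [J] on. *)
Lemma dyadic_limitP {R : realType} (u : nat -> R -> R) (M : R) :
  (forall j t, `|u j t| <= M / 2 ^+ j) ->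
  exists h, dyadic_limit (fun J t => \sum_(j < J) u j t) (M * 2) h.
Proof.
move=> uM.
have M0 : 0 <= M by have := uM 0 0; rewrite expr0 divr1; exact: le_trans.
have cu t : cvgn (series (u ^~ t)).
  apply: normed_cvg; apply: (@series_le_cvg _ _ (geometric M 2^-1)).
  - by move=> n; exact: normr_ge0.
  - by move=> n; rewrite geometric_ge0// invr_ge0.
  - by move=> n; rewrite /geometric/= exprVn; exact: uM.
  - apply: is_cvg_geometric_series.
    by rewrite ger0_norm ?invr_ge0// invf_lt1// ltr1n.
exists (fun t => limn (series (u ^~ t))) => J t.
(* The subtracted term is the part of the tail not yet used; keeping it makes the induction on [m]
   close with an equality. *)
have bd m : `|\sum_(j < J + m) u j t - \sum_(j < J) u j t|
     <= M * 2 / 2 ^+ J - M * 2 / 2 ^+ (J + m).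
  elim: m => [|m IH]; first by rewrite addn0 !subrr normr0.
  rewrite addnS big_ord_recr/= addrAC.
  apply: (le_trans (ler_normD _ _)); apply: (le_trans (lerD IH (uM _ _))).
  have e0 : 2 ^+ (J + m) != 0 :> R by rewrite expf_neq0.
  rewrite [2 ^+ (J + m).+1]exprS; move: (2 ^+ (J + m)) (M * 2 / _) e0 => x y x0.
  by rewrite le_eqVlt; apply/orP; left; apply/eqP; field.
have cvS : `|series (u ^~ t) n - \sum_(j < J) u j t| @[n --> \oo] -->
    `|limn (series (u ^~ t)) - \sum_(j < J) u j t|.
  by apply: cvg_norm; apply: cvgB; [exact: cu|exact: cvg_cst].
apply: (cvgr_to_le cvS); near=> n.
have nJ : (J <= n)%N by near: n; exact: nbhs_infty_ge.
rewrite seriesEord/= -(subnKC nJ); apply: (le_trans (bd _)).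
by rewrite gerBl// divr_ge0 ?mulr_ge0.
Unshelve. all: by end_near. Qed.

Section DyadicLimit.
Context {R : realType} (H : nat -> R -> R) (M : R) (h : R -> R)
  (Hh : dyadic_limit H M h).

Lemma dyadic_limit_cvg t : H J t @[J --> \oo] --> h t.
Proof.
apply/cvgrPdist_le => e e0; near=> J.
apply: (le_trans (Hh J t)); apply: ltW; near: J.
have /cvgrPdist_lt /(_ e e0) := dyadic_cvg0 M.
apply: filterS => J; rewrite sub0r normrN; apply: le_lt_trans; exact: ler_norm.
Unshelve. all: by end_near. Qed.

Lemma dyadic_limit_continuous : (forall J, continuous (H J)) -> continuous h.
Proof.
move=> Hc t; apply/cvgrPdist_lt => e e0.
have [J MJ] : exists J, M / 2 ^+ J < e / 3.
  have /cvgrPdist_lt /(_ (e / 3) (divr_gt0 e0 _)) := dyadic_cvg0 M.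
  move=> /(_ (ltr0Sn _ _)) [N _ /(_ N (leqnn N))].
  by rewrite /= sub0r normrN => h1; exists N; apply: le_lt_trans h1; exact: ler_norm.
have /cvgrPdist_lt /(_ (e / 3) (divr_gt0 e0 (ltr0Sn _ _))) := Hc J t.
apply: filterS => s hs.
rewrite (_ : h t - h s = (h t - H J t) + (H J t - H J s) - (h s - H J s)); last by ring.
apply: (le_lt_trans (ler_normB _ _)).
have := ler_normD (h t - H J t) (H J t - H J s).
have := Hh J t; have := Hh J s; lra.
Qed.

Lemma dyadic_limit_periodic T : (forall J, periodic (H J) T) -> periodic h T.
Proof.
move=> Hp t; have ht := dyadic_limit_cvg (t + T).
rewrite (_ : (fun J => H J (t + T)) = H ^~ t) in ht; last first.
  by apply/funext => J; exact: Hp.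
exact: (cvg_unique _ ht (dyadic_limit_cvg t)).
Qed.

(** Uniform convergence commutes with the mean. Applied after multiplication by cos(kt) or sin(kt),
    this carries Fourier coefficients from partial sums to their limit. *)
Lemma dyadic_limit_mean : (forall J, continuous (H J)) ->
  mean (H J) @[J --> \oo] --> mean h.
Proof.
move=> Hc; have hc := dyadic_limit_continuous Hc.
apply/cvgrPdist_le => e e0; near=> J.
have -> : mean h - mean (H J) = mean (fun t => h t + -1 * H J t).
  rewrite meanD//; first by rewrite meanZ// mulN1r.
  by move=> t; apply: cvgMr; exact: Hc.
apply: (@le_trans _ _ (M / 2 ^+ J)).
  apply: mean_bound; last by move=> t; rewrite mulN1r.
  by move=> t; apply: cvgD; [exact: hc|apply: cvgMr; exact: Hc].
apply: ltW; near: J.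
have /cvgrPdist_lt /(_ e e0) := dyadic_cvg0 M.
apply: filterS => J; rewrite sub0r normrN; apply: le_lt_trans; exact: ler_norm.
Unshelve. all: by end_near. Qed.

End DyadicLimit.

(** Split fg - FG as (f - F)g + F(g - G). Each constant serves both as a rate and as a bound, so the
    two summands contribute M N each. *)
Lemma dyadic_limitM {R : realType} (F G : nat -> R -> R) (M N : R) (f g : R -> R) :
  dyadic_limit F M f -> dyadic_limit G N g ->
  (forall t, `|g t| <= N) -> (forall J t, `|F J t| <= M) ->
  dyadic_limit (fun J t => F J t * G J t) (2 * M * N) (fun t => f t * g t).
Proof.
move=> Ff Gg gN FM J t.
rewrite (_ : _ - _ = (f t - F J t) * g t + F J t * (g t - G J t)); last by ring.
apply: (le_trans (ler_normD _ _)); rewrite !normrM.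
have -> : 2 * M * N / 2 ^+ J = M / 2 ^+ J * N + M * (N / 2 ^+ J) by ring.
by apply: lerD; apply: ler_pM.
Qed.

Lemma dyadic_limit_mulr {R : realType} (F : nat -> R -> R) (M : R) (f p : R -> R) :
  dyadic_limit F M f -> (forall t, `|p t| <= 1) ->
  dyadic_limit (fun J t => F J t * p t) M (fun t => f t * p t).
Proof.
move=> Ff p1 J t; rewrite -mulrBl normrM -[leRHS]mulr1.
by apply: ler_pM.
Qed.

(** * The Fejer means of the sawtooth function *)

(** The index [l] stands for the frequency k = l + 1: the coefficient 1/k of the sawtooth (pi -
    t)/2, damped by the Fejer factor 1 - k/(n+1). *)
Definition fejer_weight {R : realType} (n l : nat) : R :=
  (1 - l.+1%:R / n.+1%:R) / l.+1%:R.

Definition sinw {R : realType} (m : nat) (t : R) : R := sin (m%:~R * t).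

Definition fejer_saw {R : realType} (n : nat) (t : R) : R :=
  \sum_(l < n) fejer_weight n l * sinw l.+1 t.

(** Both sides are the squared modulus of the sum of e^(ikt) over 0 <= k <= n, that is, n+1 times
    the Fejer kernel: the frequency difference l+1 occurs n-l times with each sign. *)
Lemma fejer_kernelE {R : realType} (n : nat) (t : R) :
  (\sum_(k < n.+1) cos (k%:R * t)) ^+ 2 + (\sum_(k < n.+1) sin (k%:R * t)) ^+ 2 =
  n.+1%:R + 2 * \sum_(l < n) (n%:R - l%:R) * cos (l.+1%:R * t).
Proof.
elim: n => [|n IH].
  by rewrite !big_ord_recl !big_ord0 !mul0r cos0 sin0; ring.
rewrite big_ord_recr/= [X in _ + X ^+ 2]big_ord_recr/=.
set C := \sum_(i < n.+1) _ in IH *; set S := \sum_(i < n.+1) _ in IH *.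
set c := cos _; set s := sin _.
have cs : c ^+ 2 + s ^+ 2 = 1 by rewrite /c /s cos2Dsin2.
(* The new frequency n+1 paired with an old k gives cos((n+1-k)t); reversing the order of summation
   lists these differences as l+1. *)
have CS : C * c + S * s = \sum_(l < n.+1) cos (l.+1%:R * t).
  rewrite (reindex_inj rev_ord_inj)/= /C /S !mulr_suml -big_split/=.
  apply: eq_bigr => i _; rewrite /c /s -cosB -cosN; congr cos.
  have iN : (i <= n)%N by rewrite -ltnS ltn_ord.
  rewrite subSS -[(n - i).+1%:R]natr1 -[n.+1%:R]natr1 natrB//.
  by rewrite -mulrBl -mulNr; congr (_ * t); lra.
have -> : \sum_(l < n.+1) (n.+1%:R - l%:R) * cos (l.+1%:R * t) =
    \sum_(l < n) (n%:R - l%:R) * cos (l.+1%:R * t) +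
    \sum_(l < n.+1) cos (l.+1%:R * t).
  rewrite big_ord_recr/= [X in _ = _ + X]big_ord_recr/= addrA -big_split/=.
  congr (_ + _); last by rewrite -natr1; ring.
  by apply: eq_bigr => i _; rewrite -natr1; ring.
rewrite -CS (_ : n.+2%:R = n.+1%:R + 1 :> R); last by rewrite natr1.
rewrite (_ : _ + _ = (C ^+ 2 + S ^+ 2) + (C * c + S * s) * 2 + (c ^+ 2 + s ^+ 2));
  last by move: C S c s {IH cs CS} => C S c s; ring.
by rewrite IH cs; move: (C * c + S * s) (\sum_(l < n) _) => x y; ring.
Qed.

Lemma is_derive_bigsum {R : realType} (I : Type) (r : seq I) (u : I -> R -> R)
    (du : I -> R) (t : R) :
  (forall i, is_derive t 1 (u i) (du i)) ->
  is_derive t 1 (fun s => \sum_(i <- r) u i s) (\sum_(i <- r) du i).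
Proof.
move=> ud; elim: r => [|i r IH].
  rewrite big_nil; under eq_fun do rewrite big_nil.
  exact: is_derive_cst.
rewrite big_cons; under eq_fun do rewrite big_cons.
exact: is_deriveD.
Qed.

(** Termwise differentiation gives half the Fejer kernel without its constant term, which s/2
    restores. Writing the result as a sum of squares makes its sign evident. *)
Lemma is_derive_fejer_saw {R : realType} (n : nat) (t : R) :
  is_derive t 1 (fun s => fejer_saw n s + s / 2)
    (((\sum_(k < n.+1) cos (k%:R * t)) ^+ 2 +
      (\sum_(k < n.+1) sin (k%:R * t)) ^+ 2) / (2 * n.+1%:R)).
Proof.
rewrite fejer_kernelE.
have n0 : n.+1%:R != 0 :> R by rewrite pnatr_eq0.
have -> : (n.+1%:R + 2 * \sum_(l < n) (n%:R - l%:R) * cos (l.+1%:R * t)) /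
    (2 * n.+1%:R) =
    \sum_(l < n) fejer_weight n l * (l.+1%:~R * cos (l.+1%:~R * t)) + 2^-1.
  transitivity (\sum_(l < n) ((n%:R - l%:R) / n.+1%:R) * cos (l.+1%:R * t) + 2^-1).
    have -> : \sum_(l < n) (n%:R - l%:R) / n.+1%:R * cos (l.+1%:R * t) =
        (\sum_(l < n) (n%:R - l%:R) * cos (l.+1%:R * t)) / n.+1%:R.
      by rewrite mulr_suml; apply: eq_bigr => i _; ring.
    by field.
  congr (_ + _); apply: eq_bigr => i _; rewrite -pmulrn mulrA; congr (_ * _).
  have i0 : i.+1%:R != 0 :> R by rewrite pnatr_eq0.
  rewrite /fejer_weight; have -> : n%:R = n.+1%:R - 1 :> R by rewrite -natr1 addrK.
  have -> : i%:R = i.+1%:R - 1 :> R by rewrite -natr1 addrK.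
  by move: n.+1%:R i.+1%:R n0 i0 => x y x0 y0; field; rewrite x0 y0.
have dl : is_derive t 1 (fun s => s / 2) 2^-1.
  have := @is_deriveZ R R R id 2^-1 t 1 1 (is_derive_id _ _).
  rewrite /GRing.scale/= mulr1 (_ : _ \*: id = fun s => s / 2)//.
  by apply/funext => s; rewrite /GRing.scale/= mulrC.
apply: is_deriveD.
  apply: is_derive_bigsum => l.
  exact: (@is_deriveZ R R R _ _ t 1 _ (is_derive_sinM _ t)).
Qed.

Lemma fejer_saw_nondecreasing {R : realType} (n : nat) (s t : R) : s <= t ->
  fejer_saw n s + s / 2 <= fejer_saw n t + t / 2.
Proof.
move=> st; have dF := @is_derive_fejer_saw R n.
apply: (@ger0_derive1_ndecr R (fun s => fejer_saw n s + s / 2) s t) => //.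
- move=> x _; rewrite derive1E (@derive_val _ _ _ _ _ _ _ (dF x)).
  by rewrite divr_ge0// ?addr_ge0 ?sqr_ge0// mulr_ge0.
- apply: continuous_subspaceT => x.
  apply/differentiable_continuous/derivable1_diffP.
  exact: (@ex_derive _ _ _ _ _ _ _ (dF x)).
Qed.

Lemma sinw_periodic {R : realType} m : periodic (@sinw R m) (pi *+ 2).
Proof. by move=> t; exact: sin_int_period. Qed.

Lemma sinw0 {R : realType} m : sinw m 0 = 0 :> R.
Proof. by rewrite /sinw mulr0 sin0. Qed.

Lemma sinw_continuous {R : realType} m : continuous (@sinw R m).
Proof. exact: continuous_sinM. Qed.

Lemma sinw_le1 {R : realType} m (t : R) : `|sinw m t| <= 1.
Proof. exact: sin_max. Qed.

Lemma fejer_saw_periodic {R : realType} n : periodic (@fejer_saw R n) (pi *+ 2).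
Proof.
move=> t; rewrite /fejer_saw; apply: eq_bigr => l _.
by rewrite sinw_periodic.
Qed.

Lemma fejer_saw0 {R : realType} n : fejer_saw n 0 = 0 :> R.
Proof. by rewrite /fejer_saw big1// => l _; rewrite sinw0 mulr0. Qed.

Lemma fejer_saw_continuous {R : realType} n : continuous (@fejer_saw R n).
Proof.
apply: continuous_sum => l t; apply: cvgMr; exact: sinw_continuous.
Qed.

Lemma periodic_reduce {R : realType} (h : R -> R) (T t : R) : 0 < T ->
  periodic h T -> exists2 s : R, 0 <= s <= T & h t = h s.
Proof.
move=> T0 hp; have /andP[k1 k2] := floor_itv (t / T).
exists (t - (Num.floor (t / T))%:~R * T).
  rewrite ler_pdivlMr// in k1; rewrite ltr_pdivrMr// in k2.
  by rewrite subr_ge0 k1/= lerBlDr -[X in X + _]mul1r -mulrDl addrC -intrD1 ltW.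
case: (Num.floor _) => n.
  by rewrite -[in LHS](subrK (n%:~R * T) t) -pmulrn mulr_natl (periodicn hp).
by rewrite NegzE mulrNz mulNr opprK -pmulrn mulr_natl (periodicn hp).
Qed.

(** On [0, 2 pi] the function F_n + s/2 is nondecreasing and F_n vanishes at both ends, so F_n(s)
    lies between -s/2 and pi - s/2. *)
Lemma fejer_saw_bound {R : realType} n (t : R) : `|fejer_saw n t| <= pi.
Proof.
have [s /andP[s0 s2] ->] :=
  periodic_reduce _ _ t pi2_gt0 (@fejer_saw_periodic R n).
have := @fejer_saw_nondecreasing R n _ _ s0.
have := @fejer_saw_nondecreasing R n _ _ s2.
have -> : fejer_saw n (pi *+ 2) = 0 :> R.
  by rewrite -[pi *+ 2]add0r fejer_saw_periodic fejer_saw0.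
rewrite fejer_saw0 => h1 h2.
rewrite ler_norml; move: s2 h1 h2; rewrite -mulr_natr; lra.
Qed.

(** * Fourier coefficients of sines and of their products *)

Lemma coscZsum {R : realType} (I : Type) (r : seq I) (c : I -> R)
    (u : I -> R -> R) (k : int) : (forall i, continuous (u i)) ->
  cosc (fun t => \sum_(i <- r) c i * u i t) k = \sum_(i <- r) c i * cosc (u i) k.
Proof.
move=> uc; rewrite /cosc.
transitivity (\sum_(i <- r) mean (fun t => c i * (u i t * cos (k%:~R * t)))).
  rewrite -mean_sum; last first.
    by move=> i t; apply: cvgMr; exact: continuous_mulcos.
  congr mean; apply/funext => t; rewrite mulr_suml; apply: eq_bigr => i _.
  by rewrite mulrA.
by apply: eq_bigr => i _; rewrite meanZ//; exact: continuous_mulcos.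
Qed.

Lemma sincZsum {R : realType} (I : Type) (r : seq I) (c : I -> R)
    (u : I -> R -> R) (k : int) : (forall i, continuous (u i)) ->
  sinc (fun t => \sum_(i <- r) c i * u i t) k = \sum_(i <- r) c i * sinc (u i) k.
Proof.
move=> uc; rewrite /sinc.
transitivity (\sum_(i <- r) mean (fun t => c i * (u i t * sin (k%:~R * t)))).
  rewrite -mean_sum; last first.
    by move=> i t; apply: cvgMr; exact: continuous_mulsin.
  congr mean; apply/funext => t; rewrite mulr_suml; apply: eq_bigr => i _.
  by rewrite mulrA.
by apply: eq_bigr => i _; rewrite meanZ//; exact: continuous_mulsin.
Qed.

Lemma mean_sin_cos {R : realType} (m k : int) :
  mean (fun t : R => sin (m%:~R * t) * cos (k%:~R * t)) = 0.
Proof.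
rewrite (_ : (fun t => _) = fun t =>
   2^-1 * sin ((m + k)%:~R * t) + 2^-1 * sin ((m - k)%:~R * t)); last first.
  apply/funext => t.
  by rewrite intrB intrD mulrBl mulrDl sinB sinD; field.
rewrite meanD; try by move=> t; apply: cvgMr; exact: continuous_sinM.
by rewrite !meanZ ?mean_sin ?mulr0 ?addr0//; exact: continuous_sinM.
Qed.

Lemma mean_cos_cos {R : realType} (m k : int) :
  mean (fun t : R => cos (m%:~R * t) * cos (k%:~R * t)) =
  2^-1 * ((k == m)%:R + (k == - m)%:R).
Proof.
rewrite (_ : (fun t => _) = fun t =>
   2^-1 * cos ((m - k)%:~R * t) + 2^-1 * cos ((m + k)%:~R * t)); last first.
  apply/funext => t.
  by rewrite intrB intrD mulrBl mulrDl cosB cosD; field.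
rewrite meanD; try by move=> t; apply: cvgMr; exact: continuous_cosM.
rewrite !meanZ; try exact: continuous_cosM.
by rewrite !mean_cos subr_eq0 addr_eq0 -mulrDr eq_sym -eqr_oppLR [- m == _]eq_sym.
Qed.

Lemma mean_sin_sin {R : realType} (m k : int) :
  mean (fun t : R => sin (m%:~R * t) * sin (k%:~R * t)) =
  2^-1 * ((k == m)%:R - (k == - m)%:R).
Proof.
rewrite (_ : (fun t => _) = fun t =>
   2^-1 * cos ((m - k)%:~R * t) + (- 2^-1) * cos ((m + k)%:~R * t)); last first.
  apply/funext => t.
  by rewrite intrB intrD mulrBl mulrDl cosB cosD; field.
rewrite meanD; try by move=> t; apply: cvgMr; exact: continuous_cosM.
rewrite !meanZ; try exact: continuous_cosM.
rewrite !mean_cos subr_eq0 addr_eq0 mulNr -mulrBr eq_sym.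
by rewrite -eqr_oppLR [- m == _]eq_sym.
Qed.

Lemma cosc_sinw {R : realType} (m : nat) (k : int) : cosc (@sinw R m) k = 0.
Proof. exact: mean_sin_cos. Qed.

(** The k-th Fourier coefficient of sin(mt) is -i/2 times this number. As a difference of indicators
    it is identically 0 for m = 0. *)
Definition freq_sign {R : realType} (m : nat) (k : int) : R :=
  (k == m%:Z)%:R - (k == - m%:Z)%:R.

Lemma sinc_sinw {R : realType} (m : nat) (k : int) :
  sinc (@sinw R m) k = 2^-1 * freq_sign m k.
Proof. exact: mean_sin_sin. Qed.

(** For [c := cosc h] this is the real part of the N-th partial sum of [h] at 0, where all
    exponentials equal 1. *)
Definition symsum {R : realType} (N : nat) (c : int -> R) : R :=
  \sum_(j < N.*2.+1) c (j%:Z - N%:Z).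

Lemma symsum_indic {R : realType} (N : nat) (q : int) :
  symsum N (fun k => (k == q)%:R) = (absz q <= N)%N%:R :> R.
Proof.
rewrite /symsum; have [qN|qN] := leqP (absz q) N.
  (* The frequency q sits at the index q + N, which is nonnegative here. *)
  have lt : (absz (q + N%:Z)%R < N.*2.+1)%N by lia.
  rewrite (bigD1 (Ordinal lt))//= [X in nat_of_bool X](_ : _ = true); last first.
    by apply/eqP; lia.
  rewrite big1 ?addr0// => i /eqP ni; case: eqP => // iq; exfalso; apply: ni.
  by apply/val_inj => /=; lia.
by rewrite big1// => i _; case: eqP => // iq; have := ltn_ord i; lia.
Qed.

(** The product is (cos((m-p)t) - cos((m+p)t))/2, and the N-th partial sum of cos(qt) at 0 is 1 or 0
    according to whether |q| <= N. *)
Lemma symsum_cosc_sinw_sinw {R : realType} (N m p : nat) :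
  symsum N (cosc (fun t : R => sinw m t * sinw p t)) =
  2^-1 * ((absz (m%:Z - p%:Z)%R <= N)%N%:R - (m + p <= N)%N%:R).
Proof.
have prodE k : cosc (fun t : R => sinw m t * sinw p t) k =
   4^-1 * ((k == m%:Z - p%:Z)%:R + (k == - (m%:Z - p%:Z))%:R -
     (k == (m + p)%:Z)%:R - (k == - (m + p)%:Z)%:R).
  rewrite /cosc (_ : (fun t => _) = fun t =>
   2^-1 * (cos ((m%:Z - p%:Z)%:~R * t) * cos (k%:~R * t)) +
   (- 2^-1) * (cos ((m + p)%:Z%:~R * t) * cos (k%:~R * t))); last first.
    apply/funext => t; rewrite /sinw PoszD.
    by rewrite intrB intrD mulrBl mulrDl cosB cosD; field.
  have cc a b : continuous (fun t : R => cos (a * t) * cos (b * t)).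
    by apply: continuous_mulcos; exact: continuous_cosM.
  rewrite meanD; try by move=> t; apply: cvgMr; exact: cc.
  rewrite !meanZ; try exact: cc.
  by rewrite !mean_cos_cos; field.
rewrite /symsum; under eq_bigr do rewrite prodE.
rewrite -mulr_sumr !(sumrB, big_split)/=.
have ind := @symsum_indic R N; rewrite /symsum in ind.
by rewrite !ind !abszN [absz (Posz _)]/absz; field.
Qed.

(** Since |m-p| <= m+p, the subtracted indicator never exceeds the other one. This sign is what
    allows all off-diagonal terms to be dropped. *)
Lemma symsum_cosc_ge0 {R : realType} (N m p : nat) :
  0 <= symsum N (cosc (fun t : R => sinw m t * sinw p t)).
Proof.
rewrite symsum_cosc_sinw_sinw mulr_ge0// subr_ge0 ler_nat.
by do 2![case: leqP => //]; lia.
Qed.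

Lemma symsum_cosc_diag {R : realType} (N p : nat) : (0 < p <= N)%N ->
  symsum N (cosc (fun t : R => sinw N t * sinw p t)) = 2^-1.
Proof.
move=> /andP[p0 pN]; rewrite symsum_cosc_sinw_sinw.
have -> : (absz (N%:Z - p%:Z)%R <= N)%N by lia.
by rewrite leqNgt -[X in (X < _)%N]addn0 ltn_add2l p0 subr0 mulr1.
Qed.

Lemma symsum_coscZsum {R : realType} (N : nat) (I : Type) (r : seq I) (c : I -> R)
    (u : I -> R -> R) : (forall i, continuous (u i)) ->
  symsum N (cosc (fun t => \sum_(i <- r) c i * u i t)) =
  \sum_(i <- r) c i * symsum N (cosc (u i)).
Proof.
move=> uc; rewrite /symsum.
under eq_bigr do rewrite coscZsum//.
rewrite exchange_big/=; apply: eq_bigr => i _.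
by rewrite mulr_sumr.
Qed.

(** * Sums of sine coefficients over finite sets of frequencies, given as duplicate-free lists *)

Lemma freq_sign_neq0 {R : realType} (m : nat) (k : int) :
  freq_sign m k != 0 :> R -> absz k = m.
Proof.
rewrite /freq_sign; case: (k =P m%:Z) => [->//|_].
case: (k =P - m%:Z) => [->|_]; first by rewrite abszN.
by rewrite subrr eqxx.
Qed.

Lemma freq_sign_norm {R : realType} (m : nat) (k : int) :
  `|freq_sign m k : R| <= (k == m%:Z)%:R + (k == - m%:Z)%:R.
Proof.
rewrite /freq_sign; apply: (le_trans (ler_normB _ _)).
by rewrite !ger0_norm.
Qed.

Lemma freq_sign_sqr {R : realType} (m : nat) (k : int) :
  (freq_sign m k : R) ^+ 2 <= (k == m%:Z)%:R + (k == - m%:Z)%:R.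
Proof.
by rewrite /freq_sign; do 2!case: eqP => _; rewrite /=; lra.
Qed.

Lemma sum_indic_uniq {R : realType} (r : seq int) (m : int) : uniq r ->
  \sum_(k <- r) (k == m)%:R <= 1 :> R.
Proof.
move=> ur; rewrite -natr_sum -[leRHS]/(1%:R) ler_nat.
by rewrite -[X in (X <= _)%N]big_mkcond/= sum1_count count_uniq_mem// leq_b1.
Qed.

Lemma sum_freq_sign_norm {R : realType} (r : seq int) (m : nat) : uniq r ->
  \sum_(k <- r) `|freq_sign m k : R| <= 2.
Proof.
move=> ur; apply: (le_trans (ler_sum _ (fun k _ => freq_sign_norm m k))).
by rewrite big_split/= -[leRHS]/(1 + 1) lerD// sum_indic_uniq.
Qed.

Lemma sum_freq_sign_sqr {R : realType} (r : seq int) (m : nat) : uniq r ->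
  \sum_(k <- r) (freq_sign m k : R) ^+ 2 <= 2.
Proof.
move=> ur; apply: (le_trans (ler_sum _ (fun k _ => freq_sign_sqr m k))).
by rewrite big_split/= -[leRHS]/(1 + 1) lerD// sum_indic_uniq.
Qed.

(** The cross terms vanish because distinct positive frequencies m have disjoint supports {m,
    -m}. *)
Lemma sqr_sum_freq_sign {R : realType} (n : nat) (x : nat -> R) (k : int) :
  (\sum_(l < n) x l * freq_sign l.+1 k) ^+ 2 =
  \sum_(l < n) (x l) ^+ 2 * (freq_sign l.+1 k) ^+ 2.
Proof.
elim: n => [|n IH]; first by rewrite !big_ord0 expr0n.
rewrite !big_ord_recr/= sqrrD IH exprMn.
suff -> : (\sum_(i < n) x i * freq_sign i.+1 k) * (x n * freq_sign n.+1 k) = 0.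
  by rewrite mul0rn addr0.
have [->|kn] := eqVneq (freq_sign n.+1 k : R) 0; first by rewrite !mulr0.
rewrite big1 ?mul0r// => i _; apply/eqP; rewrite mulf_eq0; apply/orP; right.
apply/eqP/eqP; apply: contraT => /freq_sign_neq0 ki.
have := freq_sign_neq0 _ _ kn; rewrite ki => -[] e.
by have := ltn_ord i; rewrite e ltnn.
Qed.

(** * Harmonic numbers and the energy of the Fejer sums *)

Definition harm {R : realType} (n : nat) : R := \sum_(l < n) l.+1%:R^-1.

Lemma fejer_weight_ge0 {R : realType} n l : (l < n)%N -> 0 <= fejer_weight n l :> R.
Proof.
move=> ln; rewrite divr_ge0// subr_ge0 ler_pdivrMr// mul1r ler_nat.
by rewrite ltnW.
Qed.

Lemma fejer_weight_le {R : realType} n l : fejer_weight n l <= l.+1%:R^-1 :> R.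
Proof.
rewrite /fejer_weight ler_piMl ?invr_ge0// gerBl; exact: divr_ge0.
Qed.

(** Damping removes exactly 1/(n+1) from each of the n terms, hence less than 1 altogether. *)
Lemma sum_fejer_weight {R : realType} n :
  harm n - 1 <= \sum_(l < n) fejer_weight n l :> R.
Proof.
have -> : \sum_(l < n) fejer_weight n l = harm n - \sum_(l < n) n.+1%:R^-1 :> R.
  rewrite /harm -sumrB; apply: eq_bigr => l _; rewrite /fejer_weight mulrBl mul1r.
  by rewrite mulrAC divff ?mul1r// pnatr_eq0.
rewrite lerB// sumr_const card_ord -[_ *+ n]mulr_natl ler_pdivrMr// mul1r ler_nat.
exact: leqnSn.
Qed.

(** The increment of the logarithm is ln(1 + 1/(n+1)) <= 1/(n+1). *)
Lemma lnS_le_harm {R : realType} n : ln n.+1%:R <= harm n :> R.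
Proof.
elim: n => [|n IH]; first by rewrite ln1 /harm big_ord0.
rewrite /harm big_ord_recr/= -/(harm n).
have n0 : 0 < n.+1%:R :> R by rewrite ltr0Sn.
have i0 : 0 < n.+1%:R^-1 :> R by rewrite invr_gt0 ltr0Sn.
have -> : n.+2%:R = n.+1%:R * (1 + n.+1%:R^-1) :> R.
  by rewrite mulrDr mulr1 mulfV ?gt_eqF// natr1.
rewrite lnM ?posrE ?addr_gt0//.
by rewrite lerD// le_ln1Dx// (lt_trans _ i0)// ltrN10.
Qed.

Lemma ln_le_harm {R : realType} n : ln n%:R <= harm n :> R.
Proof.
(* At n = 0 the default value of [ln] at 0 is 0, equal to the empty sum. *)
case: n => [|n]; first by rewrite /harm big_ord0 ln0.
apply: le_trans (lnS_le_harm _); rewrite ler_ln ?posrE ?ltr0Sn//.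
by rewrite ler_nat.
Qed.

Lemma harm_ge2 {R : realType} n : (4 <= n)%N -> 2 <= harm n :> R.
Proof.
elim: n => // n IH; rewrite leq_eqVlt => /predU1P[<-|n4].
  (* The fourth harmonic number is 25/12. *)
  by rewrite /harm !big_ord_recr/= big_ord0; lra.
apply: (le_trans (IH n4)); rewrite /harm [leRHS]big_ord_recr/= lerDl.
by rewrite invr_ge0.
Qed.

(** With [b j] = 2^-j, of total at most 2, this controls the energy of the series g by the energies
    of its terms, whose spectra may overlap. *)
Lemma weighted_cauchy_schwarz {R : realType} (n : nat) (b x : nat -> R) :
  (forall j, 0 <= b j) ->
  (\sum_(j < n) b j * x j) ^+ 2 <=
  (\sum_(j < n) b j) * \sum_(j < n) b j * x j ^+ 2.
Proof.
move=> b0; elim: n => [|n IH]; first by rewrite !big_ord0 expr0n mul0r.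
rewrite !big_ord_recr/=; set S := \sum_(j < n) b j * x j in IH *.
set B := \sum_(j < n) b j in IH *.
set Q := \sum_(j < n) b j * x j ^+ 2 in IH *.
have B0 : 0 <= B by apply: sumr_ge0.
have Q0 : 0 <= Q by apply: sumr_ge0 => i _; rewrite mulr_ge0// sqr_ge0.
move: S B Q (x n) (b n) (b0 n) IH B0 Q0 => S B Q y c c0 IH B0 Q0.
(* AM-GM, using S^2 <= B Q *)
have amgm : 2 * S * y <= B * y ^+ 2 + Q.
  have R0 : 0 <= B * y ^+ 2 + Q by rewrite addr_ge0// mulr_ge0// sqr_ge0.
  apply: (le_trans (ler_norm _)); rewrite -(ger0_norm R0) -ler_sqr ?nnegrE//.
  rewrite !real_normK ?num_real//.
  have h1 : (2 * S * y) ^+ 2 <= 4 * (B * Q) * y ^+ 2.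
    rewrite (_ : (2 * S * y) ^+ 2 = 4 * S ^+ 2 * y ^+ 2); last by ring.
    by rewrite ler_wpM2r ?sqr_ge0// ler_wpM2l.
  apply: (le_trans h1); rewrite -subr_ge0.
  rewrite (_ : _ - _ = (B * y ^+ 2 - Q) ^+ 2); last by ring.
  exact: sqr_ge0.
have h2 := ler_wpM2l c0 amgm.
rewrite (_ : (S + c * y) ^+ 2 = S ^+ 2 + c * (2 * S * y) + (c * y) ^+ 2); last by ring.
rewrite (_ : (B + c) * (Q + c * y ^+ 2) =
  B * Q + c * (B * y ^+ 2 + Q) + (c * y) ^+ 2); last by ring.
by rewrite lerD2r lerD.
Qed.

Lemma fejer_saw_sinc {R : realType} n k :
  sinc (@fejer_saw R n) k = \sum_(l < n) fejer_weight n l / 2 * freq_sign l.+1 k.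
Proof.
rewrite /fejer_saw sincZsum; last by move=> i; exact: sinw_continuous.
by apply: eq_bigr => l _; rewrite sinc_sinw mulrA.
Qed.

Lemma fejer_saw_cosc {R : realType} n k : cosc (@fejer_saw R n) k = 0.
Proof.
rewrite /fejer_saw coscZsum; last by move=> i; exact: sinw_continuous.
by apply: big1 => l _; rewrite cosc_sinw mulr0.
Qed.

(** At each of the two frequencies of modulus l+1 the squared coefficient is at most 1/(4(l+1)^2);
    with the weight l+1 the pair gives at most 1/(2(l+1)). *)
Lemma fejer_saw_energy {R : realType} n (r : seq int) : uniq r ->
  \sum_(k <- r) sinc (@fejer_saw R n) k ^+ 2 * (absz k)%:R <= harm n / 2.
Proof.
move=> ur.
have -> : \sum_(k <- r) sinc (@fejer_saw R n) k ^+ 2 * (absz k)%:R =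
  \sum_(l < n) (fejer_weight n l / 2) ^+ 2 * l.+1%:R *
     \sum_(k <- r) freq_sign l.+1 k ^+ 2.
  under [RHS]eq_bigr do rewrite mulr_sumr.
  rewrite exchange_big/=; apply: eq_bigr => k _.
  rewrite fejer_saw_sinc (sqr_sum_freq_sign n (fun l => fejer_weight n l / 2)).
  rewrite mulr_suml; apply: eq_bigr => l _.
  have [->|kl] := eqVneq (freq_sign l.+1 k : R) 0; first by rewrite expr0n !mulr0 mul0r.
  by rewrite (freq_sign_neq0 _ _ kl); ring.
rewrite /harm mulr_suml; apply: ler_sum => l _.
have w0 := @fejer_weight_ge0 R n l (ltn_ord l).
have w1 := @fejer_weight_le R n l.
have l0 : 0 < l.+1%:R :> R by rewrite ltr0Sn.
have h : (fejer_weight n l / 2) ^+ 2 * l.+1%:R <= l.+1%:R^-1 / 4 :> R.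
  have -> : l.+1%:R^-1 / 4 = (l.+1%:R^-1 / 2) ^+ 2 * l.+1%:R :> R.
    by field; rewrite gt_eqF.
  have a0 : 0 <= fejer_weight n l / 2 :> R by rewrite divr_ge0.
  have ab : fejer_weight n l / 2 <= l.+1%:R^-1 / 2 :> R by rewrite ler_pM2r.
  by rewrite ler_wpM2r ?ler0n// ler_sqr ?nnegrE// (le_trans a0).
have h2 := @sum_freq_sign_sqr R r l.+1 ur.
have -> : l.+1%:R^-1 / 2 = l.+1%:R^-1 / 4 * 2 :> R by field; rewrite gt_eqF.
apply: ler_pM => //; last by apply: sumr_ge0 => i _; exact: sqr_ge0.
by rewrite mulr_ge0 ?sqr_ge0// ltW.
Qed.

(** * The function spaces *)

Lemma normc_realE {R : realType} (x : R) : normc x%:C = `|x|.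
Proof. by rewrite /normc/= expr0n addr0 sqrtr_sqr. Qed.

Lemma normc_imagE {R : realType} (x : R) : normc (0 +i* x) = `|x|.
Proof. by rewrite /normc/= expr0n add0r sqrtr_sqr. Qed.

Lemma Re_le_normc {R : realType} (z : R[i]) : `|complex.Re z| <= normc z.
Proof.
case: z => a b /=; rewrite -sqrtr_sqr ler_sqrt ?addr_ge0 ?sqr_ge0//.
by rewrite lerDl sqr_ge0.
Qed.

Lemma normc_cis {R : realType} (t : R) : normc (cis t) = 1.
Proof. by rewrite /normc/= cos2Dsin2 sqrtr1. Qed.

Lemma normc_sum_le {R : realType} (I : Type) (r : seq I) (F : I -> R[i]) :
  normc (\sum_(i <- r) F i) <= \sum_(i <- r) normc (F i).
Proof.
elim: r => [|i r IH]; first by rewrite !big_nil normc0.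
rewrite !big_cons; apply: (le_trans (le_normcD _ _)).
by rewrite lerD2l.
Qed.

Lemma Re_sum {R : realType} (I : Type) (r : seq I) (F : I -> R[i]) :
  complex.Re (\sum_(i <- r) F i) = \sum_(i <- r) complex.Re (F i).
Proof.
elim: r => [|i r IH]; first by rewrite !big_nil.
by rewrite !big_cons -IH; case: (F i) (\sum_(j <- r) F j) => a b [c d].
Qed.

Lemma real_C_T {R : realType} (h : R -> R) : continuous h ->
  periodic h (pi *+ 2) -> C_T (fun t => (h t)%:C).
Proof.
move=> hc hp; split; first by move=> t; rewrite hp.
move=> t; apply/cvgrPdist_lt => e e0.
(* The norm of [R[i]] takes values in [R[i]], so epsilon is complex; being positive, it is real. *)
have eE : e = (complex.Re e)%:C.
  by case: e e0 => a b; rewrite ltcE/= => /andP[/eqP -> _].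
move: e0; rewrite eE ltcR => e0.
have /cvgrPdist_lt /(_ _ e0) := hc t; apply: filterS => s hs.
by rewrite -rmorphB/= normc_def/= expr0n addr0 sqrtr_sqr ltcR.
Qed.

Lemma real_cintegrable {R : realType} (h : R -> R) : continuous h ->
  cintegrable (`[0, pi *+ 2] : set R) (fun t => (h t)%:C).
Proof.
move=> hc; split; first exact: continuous_integrable_period.
by apply: continuous_integrable_period => x; exact: cvg_cst.
Qed.

Lemma Re_fourier_sum0 {R : realType} (h : R -> R) (N : nat) : continuous h ->
  complex.Re (fourier_sum N (fun t => (h t)%:C) 0) = symsum N (cosc h).
Proof.
move=> hc; rewrite /fourier_sum Re_sum; apply: eq_bigr => j _; cbv zeta.
by rewrite mulr0 /cis cos0 sin0 fourier_coefE//= mulr1 mulr0 subr0.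
Qed.

(** The bound [M] keeps [sup] away from its default value 0 on unbounded sets. *)
Lemma sup_norm_ge {R : realType} (u : R -> R[i]) (M : R) (t : R) :
  (forall s, normc (u s) <= M) -> normc (u t) <= sup_norm u.
Proof.
move=> uM; apply: ub_le_sup; last by exists t.
by exists M => _ [s _ <-].
Qed.

(** A convergent sequence of sup norms is bounded, and at the point 0, where [h] vanishes, the sup
    norm dominates the modulus of the partial sum. *)
Lemma U_T_bounded {R : realType} (h : R -> R) (M : R) : continuous h ->
  (forall t, `|h t| <= M) -> h 0 = 0 -> U_T (fun t => (h t)%:C) ->
  exists B, forall N, symsum N (cosc h) <= B.
Proof.
move=> hc hM h0 [_ hU].
have /cvg_seq_bounded [B [_ hB]] : cvgn (fun N => sup_norm (fun t =>
   (h t)%:C - fourier_sum N (fun t => (h t)%:C) t)) by apply: cvgP hU.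
exists (B + 1) => N.
(* Boundedness is available for every constant strictly above [B]. *)
have := hB (B + 1); rewrite ltrDl ltr01 => /(_ isT N I) /= hN.
apply: le_trans (le_trans (ler_norm _) hN).
rewrite -Re_fourier_sum0//.
set u := fun t => (h t)%:C - _.
apply: (@le_trans _ _ (normc (u 0))).
  apply: (le_trans (ler_norm _)); rewrite -normrN.
  apply: le_trans (Re_le_normc _); rewrite /u h0 (_ : 0%:C = 0)// sub0r.
  by case: (fourier_sum _ _ _) => a b.
(* This bound depends on N; it only certifies that the supremum is genuine. *)
apply: (@sup_norm_ge _ _ (M + \sum_(j < N.*2.+1)
  normc (fourier_coef (fun t => (h t)%:C) (j%:Z - N%:Z)))) => s.
rewrite /u; apply: (le_trans (le_normcD _ _)); rewrite normcN normc_realE.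
rewrite lerD//; apply: (le_trans (normc_sum_le _ _ _)).
by apply: ler_sum => j _; rewrite normcM normc_cis mulr1.
Qed.

(** A Fatou argument: the sum over the integers is a supremum of finite sums, and each of these
    passes to the limit under the uniform bound [C]. *)
Lemma esum_lim_lty {R : realType} (q : nat -> int -> R) (p : int -> R) (C : R) :
  (forall k, q J k @[J --> \oo] --> p k) ->
  (forall J r, uniq r -> \sum_(k <- r) q J k <= C) ->
  (\esum_(k in [set: int]) (p k)%:E < +oo)%E.
Proof.
move=> qp qC; apply: (@le_lt_trans _ _ C%:E); last exact: ltry.
apply: ge_ereal_sup => _ [A [finA _] <-].
rewrite fsbig_finite// sumEFin lee_fin.
apply: (@cvgr_to_le nat \oo _ R (fun J => \sum_(k <- finmap.enum_fset (fset_set A)) q J k)).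
  by apply: cvg_big => [|k _]; [exact: add_continuous|exact: qp].
by apply: nearW => J; apply: qC; exact: finmap.fset_uniq.
Qed.

(** Otherwise every quotient from index 4 on would be at least [e], and so would the lower limit.
    Starting at 4 makes the logarithm positive and, later, the harmonic number at least 2. *)
Lemma liminf_pick {R : realType} (gamma : nat -> R) (e : R) : 0 < e ->
  limn_einf (fun n : nat => (gamma n / Num.sqrt (ln (n%:R : R)))%:E) = 0%E ->
  exists2 n, (4 <= n)%N & gamma n <= e * Num.sqrt (ln n%:R).
Proof.
move=> e0 lim0; apply: contrapT => hn.
suff : (e%:E <= limn_einf (fun n : nat => (gamma n / Num.sqrt (ln (n%:R : R)))%:E))%E.
  by rewrite lim0 lee_fin leNgt e0.
rewrite limn_einf_lim; apply: lime_ge; first exact: is_cvg_einfs.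
exists 4 => // m /= m4; apply: le_ereal_inf_tmp => _ [n /= mn <-].
have n4 := leq_trans m4 mn.
have s0 : 0 < Num.sqrt (ln n%:R) :> R.
  by rewrite sqrtr_gt0 ln_gt0// ltr1n (leq_trans _ n4).
rewrite lee_fin ler_pdivlMr// leNgt; apply/negP => /ltW gn.
by apply: hn; exists n.
Qed.

(** * The counterexample *)

Lemma ler_term_sum {R : realType} (n : nat) (F : 'I_n -> R) (i : 'I_n) :
  (forall j, 0 <= F j) -> F i <= \sum_(j < n) F j.
Proof. by move=> F0; rewrite (bigD1 i)//= lerDl sumr_ge0. Qed.

Lemma sum_half_pow {R : realType} (n : nat) : \sum_(j < n) (2 ^+ j)^-1 <= 2 :> R.
Proof.
suff -> : \sum_(j < n) (2 ^+ j)^-1 = 2 - 2 / 2 ^+ n :> R.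
  by rewrite gerBl divr_ge0.
elim: n => [|n IH]; first by rewrite big_ord0 expr0 divr1 subrr.
rewrite big_ord_recr/= IH exprS.
have : 2 ^+ n != 0 :> R by rewrite expf_neq0// pnatr_eq0.
by move: (2 ^+ n) => x x0; field.
Qed.

Section Construction.
Context {R : realType} (gamma : nat -> R) (n : nat -> nat) (d : R)
  (d0 : 0 < d) (gamma_ge : forall m, d <= gamma m)
  (n4 : forall j, (4 <= n j)%N)
  (gamma_n : forall j, gamma (n j) <= Num.sqrt (ln (n j)%:R) / 8 ^+ j).

(** Dividing by [gamma (n j)] cancels the weight at the frequency n_j; in [w], dividing by the root
    of [harm (n j)] normalises the energy of the Fejer sum. *)
Let a j : R := (2 ^+ j)^-1 / gamma (n j).
Let w j : R := (2 ^+ j)^-1 / Num.sqrt (harm (n j)).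
Let fsum J t : R := \sum_(j < J) a j * sinw (n j) t.
Let gsum J t : R := \sum_(j < J) w j * fejer_saw (n j) t.

Let gamma0 m : 0 < gamma m. Proof. exact: lt_le_trans (gamma_ge m). Qed.

Let harm2 j : 2 <= harm (n j) :> R. Proof. exact: harm_ge2. Qed.

Let sharm0 j : 0 < Num.sqrt (harm (n j)) :> R.
Proof. by rewrite sqrtr_gt0 (lt_le_trans _ (harm2 j)). Qed.

Let sharm1 j : 1 <= Num.sqrt (harm (n j)) :> R.
Proof.
by rewrite -[leLHS]sqrtr1 ler_sqrt ?(le_trans _ (harm2 j))// ler1n.
Qed.

Let p0 j : 0 < (2 ^+ j)^-1 :> R. Proof. by rewrite invr_gt0 exprn_gt0. Qed.

Let a0 j : 0 <= a j. Proof. by rewrite divr_ge0// ltW. Qed.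
Let w0 j : 0 <= w j. Proof. by rewrite divr_ge0// ltW. Qed.

Let a_le j : a j <= d^-1 / 2 ^+ j.
Proof. by rewrite /a mulrC ler_pM2r// lef_pV2 ?posrE. Qed.

Let w_le j : w j <= (2 ^+ j)^-1.
Proof. by rewrite ler_pdivrMr// ler_peMr// ltW. Qed.

Let fsum_term j t : `|a j * sinw (n j) t| <= d^-1 / 2 ^+ j.
Proof.
rewrite normrM ger0_norm// -[leRHS]mulr1; apply: ler_pM => //.
exact: sinw_le1.
Qed.

Let gsum_term j t : `|w j * fejer_saw (n j) t| <= pi / 2 ^+ j.
Proof.
rewrite normrM ger0_norm// mulrC; apply: ler_pM => //.
exact: fejer_saw_bound.
Qed.

Let sum_bound (M : R) (u : nat -> R -> R) J t :
  (forall j t, `|u j t| <= M / 2 ^+ j) -> `|\sum_(j < J) u j t| <= M * 2.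
Proof.
move=> uM; apply: (le_trans (ler_norm_sum _ _ _)).
have M0 : 0 <= M by have := uM 0 0; rewrite expr0 divr1; exact: le_trans.
apply: (@le_trans _ _ (\sum_(j < J) M / 2 ^+ j)); first by apply: ler_sum.
by rewrite -mulr_sumr ler_wpM2l// sum_half_pow.
Qed.

Let fsumc J : continuous (fsum J).
Proof.
apply: continuous_sum => j t; apply: cvgMr; exact: sinw_continuous.
Qed.

Let gsumc J : continuous (gsum J).
Proof.
apply: continuous_sum => j t; apply: cvgMr; exact: fejer_saw_continuous.
Qed.

Let fsump J : periodic (fsum J) (pi *+ 2).
Proof.
by move=> t; rewrite /fsum; apply: eq_bigr => j _; rewrite sinw_periodic.
Qed.

Let gsump J : periodic (gsum J) (pi *+ 2).
Proof.
by move=> t; rewrite /gsum; apply: eq_bigr => j _; rewrite fejer_saw_periodic.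
Qed.

Let fsum0 J : fsum J 0 = 0.
Proof. by rewrite /fsum big1// => j _; rewrite sinw0 mulr0. Qed.

(** Adding t/2 makes each Fejer sum nondecreasing. The weights [w j] add up to at most 2, so the
    total correction is at most t, and what remains is a nonnegative multiple of t. *)
Let gsum_mono J s t : s <= t -> gsum J s + s <= gsum J t + t.
Proof.
move=> st; rewrite -subr_ge0.
have -> : gsum J t + t - (gsum J s + s) = (t - s) * (1 - \sum_(j < J) w j / 2) +
   \sum_(j < J) w j * (fejer_saw (n j) t + t / 2 - (fejer_saw (n j) s + s / 2)).
  have -> : \sum_(j < J) w j * (fejer_saw (n j) t + t / 2 - (fejer_saw (n j) s + s / 2))
      = gsum J t - gsum J s + (t - s) * \sum_(j < J) w j / 2.
    rewrite mulr_sumr /gsum -sumrB -big_split/=; apply: eq_bigr => j _; ring.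
  ring.
apply: addr_ge0; last first.
  by apply: sumr_ge0 => j _; rewrite mulr_ge0// subr_ge0 fejer_saw_nondecreasing.
rewrite mulr_ge0 ?subr_ge0// -mulr_suml ler_pdivrMr// mul1r.
apply: le_trans (sum_half_pow J); apply: ler_sum => j _; exact: w_le.
Qed.

Let fsum_cosc J k : cosc (fsum J) k = 0.
Proof.
rewrite /fsum coscZsum; last by move=> j; exact: sinw_continuous.
by apply: big1 => j _; rewrite cosc_sinw mulr0.
Qed.

Let gsum_cosc J k : cosc (gsum J) k = 0.
Proof.
rewrite /gsum coscZsum; last by move=> j; exact: fejer_saw_continuous.
by apply: big1 => j _; rewrite fejer_saw_cosc mulr0.
Qed.

(** The j-th sine has coefficients of modulus a_j/2 at two frequencies, so it contributes at most
    a_j gamma(n_j) = 2^-j. *)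
Lemma fsum_weighted_coef J (r : seq int) : uniq r ->
  \sum_(k <- r) `|sinc (fsum J) k| * gamma (absz k) <= 2.
Proof.
move=> ur.
apply: (@le_trans _ _ (\sum_(j < J) (2 ^+ j)^-1 * 2^-1 *
    \sum_(k <- r) `|freq_sign (n j) k : R|)).
  under [leRHS]eq_bigr do rewrite mulr_sumr.
  rewrite exchange_big/=; apply: ler_sum => k _.
  rewrite /fsum sincZsum; last by move=> j; exact: sinw_continuous.
  apply: (@le_trans _ _ ((\sum_(j < J) `|a j * sinc (sinw (n j)) k|) * gamma (absz k))).
    by rewrite ler_wpM2r ?ler_norm_sum// ltW.
  rewrite mulr_suml; apply: ler_sum => j _.
  rewrite normrM ger0_norm// sinc_sinw normrM ger0_norm ?invr_ge0//.
  have [->|kj] := eqVneq (freq_sign (n j) k : R) 0.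
    by rewrite normr0 !mulr0 mul0r.
  rewrite (freq_sign_neq0 _ _ kj) /a; have := gamma0 (n j).
  move=> /lt0r_neq0 g0; rewrite le_eqVlt; apply/orP; left; apply/eqP.
  by field; rewrite g0 expf_neq0.
apply: (@le_trans _ _ (\sum_(j < J) (2 ^+ j)^-1)); last exact: sum_half_pow.
apply: ler_sum => j _; rewrite -mulrA ler_piMr ?(ltW (p0 j))// mulrC.
by rewrite ler_pdivrMr// mul1r sum_freq_sign_norm.
Qed.

(** Cauchy-Schwarz with the weights 2^-j costs a factor 2, which the normalised energies, at most
    1/2 each, absorb. *)
Lemma gsum_energy J (r : seq int) : uniq r ->
  \sum_(k <- r) sinc (gsum J) k ^+ 2 * (absz k)%:R <= 2.
Proof.
move=> ur.
pose x k j := sinc (@fejer_saw R (n j)) k / Num.sqrt (harm (n j)).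
have gx k : sinc (gsum J) k = \sum_(j < J) (2 ^+ j)^-1 * x k j.
  rewrite /gsum sincZsum; last by move=> j; exact: fejer_saw_continuous.
  by apply: eq_bigr => j _; rewrite /w /x mulrAC -mulrA.
apply: (@le_trans _ _ (\sum_(k <- r) 2 *
    (\sum_(j < J) (2 ^+ j)^-1 * x k j ^+ 2) * (absz k)%:R)).
  apply: ler_sum => k _; rewrite ler_wpM2r// gx.
  apply: (le_trans (weighted_cauchy_schwarz J (fun j => (2 ^+ j)^-1) (x k) (fun j => ltW (p0 j)))).
  rewrite ler_wpM2r ?sum_half_pow//.
  by apply: sumr_ge0 => j _; rewrite mulr_ge0 ?sqr_ge0// ltW.
have -> : \sum_(k <- r) 2 * (\sum_(j < J) (2 ^+ j)^-1 * x k j ^+ 2) * (absz k)%:R =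
  \sum_(j < J) (2 ^+ j)^-1 * (2 / harm (n j) *
    \sum_(k <- r) sinc (@fejer_saw R (n j)) k ^+ 2 * (absz k)%:R).
  under [RHS]eq_bigr do rewrite mulrA mulr_sumr.
  rewrite exchange_big/=; apply: eq_bigr => k _.
  rewrite mulr_sumr mulr_suml; apply: eq_bigr => j _.
  rewrite /x expr_div_n sqr_sqrtr ?(le_trans _ (harm2 j))//.
  by rewrite !mulrA; ring.
apply: (@le_trans _ _ (\sum_(j < J) (2 ^+ j)^-1)); last exact: sum_half_pow.
apply: ler_sum => j _; rewrite ler_piMr ?(ltW (p0 j))//.
have H0 : 0 < harm (n j) :> R by apply: lt_le_trans (harm2 j).
rewrite mulrAC ler_pdivrMr// mul1r -ler_pdivlMl//.
by rewrite mulrC fejer_saw_energy.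
Qed.

Let fgsum_symsumE J N : symsum N (cosc (fun t => fsum J t * gsum J t)) =
  \sum_(i < J) a i * \sum_(j < J) w j * \sum_(l < n j) fejer_weight (n j) l *
    symsum N (cosc (fun t : R => sinw (n i) t * sinw l.+1 t)).
Proof.
have ssc m m' : continuous (fun t : R => sinw m t * sinw m' t).
  by apply: continuous_mulsin; exact: sinw_continuous.
have sgc m m' : continuous (fun t : R => \sum_(l < m')
    fejer_weight m' l * (sinw m t * sinw l.+1 t)).
  by apply: continuous_sum => l t; apply: cvgMr; exact: ssc.
have -> : (fun t => fsum J t * gsum J t) = fun t => \sum_(i < J) a i *
    \sum_(j < J) w j * \sum_(l < n j)
       fejer_weight (n j) l * (sinw (n i) t * sinw l.+1 t).
  apply/funext => t; rewrite /fsum mulr_suml; apply: eq_bigr => i _.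
  rewrite -mulrA /gsum mulr_sumr; congr (_ * _); apply: eq_bigr => j _.
  rewrite mulrCA /fejer_saw mulr_sumr; congr (_ * _); apply: eq_bigr => l _.
  by rewrite mulrCA.
rewrite symsum_coscZsum; last first.
  by move=> i; apply: continuous_sum => j t; apply: cvgMr; exact: sgc.
apply: eq_bigr => i _; congr (_ * _).
rewrite symsum_coscZsum; last by move=> j; exact: sgc.
apply: eq_bigr => j _; congr (_ * _).
by rewrite symsum_coscZsum// => l; exact: ssc.
Qed.

Lemma symsum_fgsum_ge J j : (j < J)%N ->
  2 ^+ j / 4 <= symsum (n j) (cosc (fun t => fsum J t * gsum J t)).
Proof.
move=> jJ; rewrite fgsum_symsumE.
have in_ge0 i j' : 0 <= \sum_(l < n j') fejer_weight (n j') l *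
    symsum (n j) (cosc (fun t : R => sinw (n i) t * sinw l.+1 t)).
  apply: sumr_ge0 => l _; rewrite mulr_ge0//; first exact: fejer_weight_ge0.
  exact: symsum_cosc_ge0.
have mid_ge0 i j' := mulr_ge0 (w0 j') (in_ge0 i j').
(* Positivity leaves only the sine of index j here, and below only the Fejer sum of the same
   index. *)
apply: le_trans (ler_term_sum J _ (Ordinal jJ) _); last first.
  by move=> i; rewrite mulr_ge0// sumr_ge0.
apply: (@le_trans _ _ (a j * (w j * ((harm (n j) - 1) / 2)))); last first.
  rewrite ler_wpM2l//=.
  apply: le_trans (ler_term_sum J _ (Ordinal jJ) _); last by move=> j'; exact: mid_ge0.
  rewrite ler_wpM2l//=.
  apply: (@le_trans _ _ ((\sum_(l < n j) fejer_weight (n j) l) / 2)).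
    by rewrite ler_pM2r// sum_fejer_weight.
  rewrite mulr_suml; apply: ler_sum => l _; rewrite symsum_cosc_diag ?ltn_ord//.
have h2 := harm2 j.
pose s : R := Num.sqrt (harm (n j)); have s0 : 0 < s by exact: sharm0.
have hs : harm (n j) = s ^+ 2 by rewrite sqr_sqrtr// (le_trans _ h2).
have gs : gamma (n j) <= s / 8 ^+ j.
  apply: (le_trans (gamma_n j)); rewrite ler_pM2r ?invr_gt0 ?exprn_gt0//.
  by rewrite ler_sqrt ?ln_le_harm// (le_trans _ h2).
have g0 := gamma0 (n j).
(* As H >= 2, (H - 1)/2 >= H/4. *)
apply: (@le_trans _ _ (a j * (w j * (s ^+ 2 / 4)))); last first.
  rewrite ler_wpM2l// ler_wpM2l//; move: h2; rewrite hs; lra.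
rewrite /a /w -/s.
have -> : (2 ^+ j)^-1 / gamma (n j) * ((2 ^+ j)^-1 / s * (s ^+ 2 / 4)) =
  s * ((2 ^+ j) ^- 2 / 4 / gamma (n j)).
  by field; rewrite !gt_eqF ?exprn_gt0.
rewrite mulrA ler_pdivlMr//.
apply: (le_trans (ler_wpM2l _ gs)); first by rewrite divr_ge0 ?exprn_ge0.
(* Two of the three factors 2^j pay for the decay of [a j] and [w j]; the third is the growth
   obtained. *)
have -> : 8 ^+ j = (2 ^+ j) ^+ 3 :> R.
  by rewrite -exprM mulnC exprM; congr (_ ^+ j); rewrite -natrX.
have : 2 ^+ j != 0 :> R by rewrite expf_neq0// pnatr_eq0.
move: (2 ^+ j) => y y0.
by rewrite le_eqVlt; apply/orP; left; apply/eqP; field.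
Qed.

Lemma counterexample : exists f g : R -> R,
    A_T gamma (fun t => (f t)%:C) /\
    (W_T (fun t => (g t)%:C) /\ V_T g /\ C_T (fun t => (g t)%:C)) /\
    ~ U_T (fun t => (f t * g t)%:C).
Proof.
have [f fl] := dyadic_limitP _ _ fsum_term; have [g gl] := dyadic_limitP _ _ gsum_term.
have fc := dyadic_limit_continuous _ _ _ fl fsumc.
have gc := dyadic_limit_continuous _ _ _ gl gsumc.
have fp := dyadic_limit_periodic _ _ _ fl _ fsump.
have gp := dyadic_limit_periodic _ _ _ gl _ gsump.
have cos1 (k t : R) : `|cos (k * t)| <= 1 by exact: cos_max.
have sin1 (k t : R) : `|sin (k * t)| <= 1 by exact: sin_max.
have fcos k : cosc f k = 0.
  have := dyadic_limit_mean _ _ _ (dyadic_limit_mulr _ _ _ _ fl (cos1 k%:~R))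
    (fun J => continuous_mulcos _ _ (fsumc J)).
  rewrite (_ : (fun J => mean _) = fun=> 0); last first.
    by apply/funext => J; exact: fsum_cosc.
  by move/(cvg_unique _ (cvg_cst _)) => /(_ (@Rhausdorff _)) /esym.
have gcos k : cosc g k = 0.
  have := dyadic_limit_mean _ _ _ (dyadic_limit_mulr _ _ _ _ gl (cos1 k%:~R))
    (fun J => continuous_mulcos _ _ (gsumc J)).
  rewrite (_ : (fun J => mean _) = fun=> 0); last first.
    by apply/funext => J; exact: gsum_cosc.
  by move/(cvg_unique _ (cvg_cst _)) => /(_ (@Rhausdorff _)) /esym.
have fsin k : sinc (fsum J) k @[J --> \oo] --> sinc f k.
  exact: (dyadic_limit_mean _ _ _ (dyadic_limit_mulr _ _ _ _ fl (sin1 k%:~R))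
    (fun J => continuous_mulsin _ _ (fsumc J))).
have gsin k : sinc (gsum J) k @[J --> \oo] --> sinc g k.
  exact: (dyadic_limit_mean _ _ _ (dyadic_limit_mulr _ _ _ _ gl (sin1 k%:~R))
    (fun J => continuous_mulsin _ _ (gsumc J))).
(* At J = 0 the partial sum is empty, so the approximation error is the function itself. *)
have fM t : `|f t| <= d^-1 * 2.
  by have := fl 0 t; rewrite /fsum big_ord0 subr0 expr0 divr1.
have gM t : `|g t| <= pi * 2.
  by have := gl 0 t; rewrite /gsum big_ord0 subr0 expr0 divr1.
have f0 : f 0 = 0.
  have := dyadic_limit_cvg _ _ _ fl 0.
  rewrite (_ : (fun J => _) = fun=> 0); last by apply/funext => J; exact: fsum0.
  by move/(cvg_unique _ (cvg_cst _)) => /(_ (@Rhausdorff _)) /esym.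
exists f, g; split; last split.
- split; first exact: real_C_T.
  rewrite (_ : (fun k => _) = fun k => (`|sinc f k| * gamma (absz k))%:E); last first.
    by apply/funext => k; rewrite fourier_coefE// fcos normc_imagE normrN.
  apply: (esum_lim_lty (fun J k => `|sinc (fsum J) k| * gamma (absz k)) _ 2).
    by move=> k; apply: cvgMl; apply: cvg_norm; exact: fsin.
  exact: fsum_weighted_coef.
- split; last split; last exact: real_C_T.
  + split; first by move=> t; rewrite gp.
    split; first exact: real_cintegrable.
    rewrite (_ : (fun k => _) = fun k => (sinc g k ^+ 2 * (absz k)%:R)%:E); last first.
      apply/funext => k; rewrite fourier_coefE// gcos normc_imagE normrN.
      by rewrite real_normK// num_real.
    apply: (esum_lim_lty (fun J k => sinc (gsum J) k ^+ 2 * (absz k)%:R) _ 2).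
      move=> k; apply: cvgMl; rewrite expr2.
      by under eq_fun do rewrite expr2; apply: cvgM; exact: gsin.
    exact: gsum_energy.
  + split => //.
    have mono s t : s <= t -> g s + s <= g t + t.
      move=> st; apply: (ler_cvg_to (a := \oo)
        (cvgD (dyadic_limit_cvg _ _ _ gl s) (cvg_cst s))
        (cvgD (dyadic_limit_cvg _ _ _ gl t) (cvg_cst t))).
      by apply: nearW => J; exact: gsum_mono.
    (* A Jordan decomposition: g is a nondecreasing function minus the identity. *)
    rewrite (_ : g = (fun t => g t + t) \+ (\- id)); last first.
      by apply/funext => t /=; rewrite addrK.
    apply: bounded_variationD; first exact: pi2_gt0.
      by apply: nondecreasing_bounded_variation => s t _ _; exact: mono.
    by apply/bounded_variationN/nondecreasing_bounded_variation => s t _ _.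
- have fgc : continuous (fun t => f t * g t).
    by move=> t; apply: cvgM; [exact: fc|exact: gc].
  have fgsumc J : continuous (fun t => fsum J t * gsum J t).
    by move=> t; apply: cvgM; [exact: fsumc|exact: gsumc].
  have fgl : dyadic_limit (fun J t => fsum J t * gsum J t) _ (fun t => f t * g t) :=
    dyadic_limitM _ _ _ _ _ _ fl gl gM (fun J t => sum_bound _ _ J t fsum_term).
  move=> /(U_T_bounded _ (d^-1 * 2 * (pi * 2)) fgc) [|| B hB].
  + by move=> t; rewrite normrM ler_pM.
  + by rewrite f0 mul0r.
  have lower j : 2 ^+ j / 4 <= B.
    (* For the fixed order n_j only finitely many coefficients enter, so the lower bound for J > j
       survives the limit in J. *)
    apply: le_trans (hB (n j)).
    apply: (@cvgr_to_ge nat \oo _ R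
        (fun J => symsum (n j) (cosc (fun t => fsum J t * gsum J t)))).
      apply: cvg_big => [|i _]; first exact: add_continuous.
      exact: (dyadic_limit_mean _ _ _ (dyadic_limit_mulr _ _ _ _ fgl (cos1 _))
        (fun J => continuous_mulcos _ _ (fgsumc J))).
    by exists j.+1 => // J jJ; exact: symsum_fgsum_ge.
  (* Since 4B/2^J tends to 0, some J has 4B < 2^J, which contradicts [lower]. *)
  have /cvgrPdist_lt /(_ 1 ltr01) [J _ /(_ J (leqnn J))] := dyadic_cvg0 (B * 4).
  rewrite /= sub0r normrN => /(le_lt_trans (ler_norm _)).
  by rewrite ltr_pdivrMr ?exprn_gt0// mul1r ltNge -ler_pdivrMr// lower.
Qed.

End Construction.

Theorem theorem5 (R : realType) (gamma : nat -> R)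
    (gamma_gt0 : forall n : nat, 0 < gamma n)
    (inf_gamma_gt0 : 0 < inf (range gamma))
    (liminf_gamma : limn_einf (fun n : nat =>
        (gamma n / Num.sqrt (ln (n%:R : R)))%:E) = 0%E) :
  exists f g : R -> R,
    A_T gamma (fun t => (f t)%:C) /\
    (W_T (fun t => (g t)%:C) /\ V_T g /\ C_T (fun t => (g t)%:C)) /\
    ~ U_T (fun t => (f t * g t)%:C).
Proof.
have gamma_ge m : inf (range gamma) <= gamma m.
  (* Positivity of [gamma] bounds the range below, so [inf] is a true lower bound. *)
  by apply: ge_inf; [exists 0 => _ [k _ <-]; exact/ltW|exists m].
have pick j : exists m, (4 <= m)%N /\ gamma m <= Num.sqrt (ln m%:R) / 8 ^+ j.
  have e0 : 0 < (8 ^+ j)^-1 :> R by rewrite invr_gt0 exprn_gt0.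
  by have [m m4 gm] := liminf_pick _ _ e0 liminf_gamma; exists m; rewrite mulrC.
have [n hn] := choice pick.
exact: (counterexample gamma n _ inf_gamma_gt0 gamma_ge (fun j => (hn j).1)
  (fun j => (hn j).2)).
Qed.
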